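(* Let $0<m\le l$, let $f_1,\dots,f_N\in\mathscr{S}_{m,l}$ be functions on $\mathbb{R}^d$, let $f=\frac1N\sum_{i=1}^N f_i$, and assume $\nabla f(0)=0$. Let $\rho\in(0,1]$, $s\in\mathbb{N}_0$, and let $\lambda_0,\dots,\lambda_s\in\mathbb{R}$ satisfy $$\lambda_t\le 0\ \text{ for } t>0,\qquad \sum_{t=0}^s\rho^{-t}\lambda_t\ge 0 .$$ Then, for any sequence $(z_t)_{t=0}^\infty$ of $\mathbb{R}^d$-valued random variables with finite second moments such that each $z_t$ is $\mathcal{F}_{t-1}$-measurable, and for any finite horizon $\tau\in\mathbb{N}_0$, $$\sum_{t=0}^\tau\sum_{k=0}^s\rho^{k-2t}\lambda_k\,\mathbb{E}\big[(g_t^m)^\top g_{t-k}^l\big]+\tilde b\Big(\sum_{t=0}^s\rho^{-t}\lambda_t\Big)\sum_{t=0}^\tau\rho^{-2t}\,\mathbb{E}\|w_t^1\|^2\ \le\ 0,$$ where $g_t^m=\nabla f(z_t)-mz_t$ and $g_t^l=\nabla f(z_t)-lz_t$ for $t\ge0$, $g_{t-k}^l=0$ for $t-k<0$, and $w_t^1=\nabla f_{\mathscr{I}_t}(z_t)-\nabla f(z_t)-\nabla f_{\mathscr{I}_t}(0)$.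
   Context: A differentiable $h:\mathbb{R}^d\to\mathbb{R}$ belongs to $\mathscr{S}_{m,l}$ if $z\mapsto h(z)-\frac m2\|z\|^2$ is convex and $z\mapsto h(z)-\frac l2\|z\|^2$ is concave. Mini-batches: $\mathscr{I}_0,\mathscr{I}_1,\dots$ are random mini-batches of size $b$ from $\{1,\dots,N\}$, independent across $t$, all sampled by one of two schemes: (i) uniform sampling with replacement ($\mathscr{I}_t$ is the multiset of $b$ i.i.d. uniform indices, counted with multiplicity); (ii) uniform sampling without replacement ($\mathscr{I}_t$ is uniformly distributed over the subsets of size $b$, with $b<N$). The mini-batch gradient is $\nabla f_{\mathscr{I}}(z)=\frac1b\sum_{i\in\mathscr{I}}\nabla f_i(z)$. The generalized batch size is $\tilde b=b$ in case (i) and $\tilde b=\frac{b(N-1)}{N-b}$ in case (ii). $(\mathcal{F}_t)_{t\ge-1}$ is a filtration such that $\mathscr{I}_t$ is $\mathcal{F}_t$-measurable and independent of $\mathcal{F}_{t-1}$. *)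

(* Defs.v *)
From HB Require Import structures.
From mathcomp Require Import all_boot all_order all_algebra finmap multiset.
From mathcomp Require Import all_classical all_reals all_analysis.

Set Implicit Arguments.
Unset Strict Implicit.
Unset Printing Implicit Defensive.

Import Order.TTheory GRing.Theory Num.Theory.
Import numFieldNormedType.Exports.

Local Open Scope classical_set_scope.
Local Open Scope ring_scope.

Section Gradients.
Context {R : realType} {d : nat}.
Implicit Types (u v z : 'rV[R]_d) (h : 'rV[R]_d -> R).

(* The library norm on row vectors is the sup norm; the Euclidean structure
   of R^d is given by [dotv] and [sqnorm]. *)
Definition dotv u v : R := (u *m v^T) 0 0.

Definition sqnorm u : R := dotv u u.

(* Partial derivatives are total in the library; this is the gradient at points
   where h is differentiable. *)
Definition grad h z : 'rV[R]_d := \row_i 'D_(delta_mx 0 i) h z.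

Definition class_S (m l : R) h : Prop :=
  [/\ forall z, differentiable h z,
      convex_function setT (fun z => h z - m / 2 * sqnorm z) &
      convex_function setT (fun z => - (h z - l / 2 * sqnorm z))].

Definition shifted_grad h (a : R) z : 'rV[R]_d := grad h z - a *: z.

End Gradients.

Section MiniBatchGradients.
Context {R : realType} {d N : nat}.
Implicit Types (f : 'I_N -> 'rV[R]_d -> R) (B : {mset 'I_N}%mset) (z : 'rV[R]_d).

Definition avg_fun f z : R := N%:R^-1 * \sum_(i < N) f i z.

(* The sum runs over the enumeration of B with multiplicities. *)
Definition batch_grad f (b : nat) B z : 'rV[R]_d :=
  b%:R^-1 *: \sum_(i <- B) grad (f i) z.

Definition batch_noise f (b : nat) B z : 'rV[R]_d :=
  batch_grad f b B z - grad (avg_fun f) z - batch_grad f b B 0.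

End MiniBatchGradients.

Section Probability.
Context {disp : measure_display} {T : measurableType disp} {R : realType}.
Variable P : probability T R.

(* F is indexed by all of int, but only the indices t >= -1 are constrained. *)
Definition filtration_from_m1 (F : int -> set (set T)) : Prop :=
  [/\ forall t : int, -1 <= t -> sigma_algebra setT (F t),
      forall t : int, -1 <= t -> F t `<=` measurable &
      forall t u : int, -1 <= t -> t <= u -> F t `<=` F u].

Definition borel_measurable_wrt {V : topologicalType} (G : set (set T))
    (X : T -> V) : Prop :=
  preimage_set_system setT X <<s open >> `<=` G.

(* For random variables with values in a countable set, which carries the
   discrete sigma-algebra. *)
Definition discrete_measurable_wrt {V : Type} (G : set (set T))
    (X : T -> V) : Prop :=
  preimage_set_system setT X setT `<=` G.

Definition independent_systems (G H : set (set T)) : Prop :=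
  forall A B, G A -> H B -> P (A `&` B) = (P A * P B)%E.

(* Product rule over every finite subfamily, for variables with values in a
   countable discrete set. *)
Definition mutually_independent {J : choiceType} {V : Type}
    (X : J -> T -> V) : Prop :=
  forall (K : seq J) (A : J -> set V), uniq K ->
    P (\bigcap_(k in [set` K]) (X k @^-1` A k)) =
    (\prod_(k <- K) P (X k @^-1` A k))%E.

End Probability.

Variant sampling_scheme := with_replacement | without_replacement.

Definition gen_batch_size (R : realType) (sch : sampling_scheme)
    (N b : nat) : R :=
  match sch with
  | with_replacement => b%:R
  | without_replacement => b%:R * (N%:R - 1) / (N%:R - b%:R)
  end.

(* Mini-batches are multisets in both schemes; under sampling without
   replacement a subset is seen as a multiset with multiplicities 0 and 1. *)
Definition sampled_by {disp : measure_display} {T : measurableType disp}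
    {R : realType} (P : probability T R) (sch : sampling_scheme) (N b : nat)
    (B : T -> {mset 'I_N}%mset) : Prop :=
  match sch with
  | with_replacement =>
      exists xi : 'I_b -> T -> 'I_N,
        [/\ forall k, discrete_measurable_wrt measurable (xi k),
            mutually_independent P xi,
            forall k i, P (xi k @^-1` [set i]) = (N%:R^-1)%:E &
            forall w, B w = seq_mset [seq xi k w | k <- enum 'I_b]]
  | without_replacement =>
      (b < N)%N /\
      forall S : {set 'I_N}, #|S| = b ->
        P (B @^-1` [set seq_mset (enum S)]) = ('C(N, b)%:R^-1)%:E
  end.

(* Main.v *)
Require Import Defs.
From HB Require Import structures.
From mathcomp Require Import all_boot all_order all_algebra finmap multiset.
From mathcomp Require Import all_classical all_reals all_analysis.
From mathcomp Require Import perm measurable_realfun ring lra.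

Set Implicit Arguments.
Unset Strict Implicit.
Unset Printing Implicit Defensive.

Import Order.TTheory GRing.Theory Num.Theory.
Import numFieldNormedType.Exports.

Local Open Scope classical_set_scope.
Local Open Scope ring_scope.

(** Why the inequality holds.

    Each f_i, and hence their average f, lies between two tangent parabolas at
    every point ([pinched], [class_S_pinched], [avg_pinched]).  For such a
    function h the usual cocoercivity argument yields an energy phi, with
    phi >= 0 = phi(0) when the gradient vanishes at 0, such that
      g^m(x).(g^l(x) - g^l(y)) <= phi(y) - phi(x)     ([energy_dissipation]).

    Delayed terms.  Apply this to f at x = z_t, y = z_(t-k), reading y as 0 for
    k > t.  Since lambda_k <= 0 for k > 0, it bounds lambda_k g^m_t.g^l_(t-k) by
    lambda_k (g^m_t.g^l_t + phi_t - phi_(t-k)).  Because rho <= 1, the weights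
    rho^k on the undelayed part may be replaced by rho^-k, after which the energy
    differences telescope with a nonpositive remainder.  With
    c = sum_k rho^-k lambda_k >= 0 this gives, along every trajectory,
      sum_(t,k) rho^(k-2t) lambda_k g^m_t.g^l_(t-k)
        <= c sum_t rho^(-2t) g^m_t.g^l_t               ([weighted_dissipation]).

    Noise.  Let u_i be the increment of the gradient of f_i from 0 to z.
    Since the gradient of f vanishes at 0, the mean of the u_i is the gradient
    of f at z, and expanding shows that
      g^m(z).g^l(z) + (variance of the u_i over i)
    is the mean over i of (u_i - m z).(u_i - l z).  Each of these is nonpositive
    because f_i itself is pinched ([deviation_budget]).  So g^m_t.g^l_t leaves room
    for the spread of the component gradients, and only for that.

    It remains to see that the expected squared noise is that spread divided
    by the generalized batch size ([noise_second_moment]).  The mini-batch is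
    independent of the past and z_t is determined by the past, so z_t can be
    frozen while the mini-batch is averaged ([independent_expectation],
    [expectation_frozen]); what is left is the second moment of a sum of
    centred vectors sampled with or without replacement ([sum_ffun_sqnorm],
    [sum_subset_sqnorm]).  Gradients are Lipschitz, hence continuous, which
    gives measurability, and of linear growth, which gives integrability from the
    second moments of z_t. *)

(** * Euclidean structure *)

Section Euclidean.
Context {R : realType} {d : nat}.
Implicit Types (u v w : 'rV[R]_d) (a : R).

Lemma dotvE u v : dotv u v = \sum_j u 0 j * v 0 j.
Proof. by rewrite /dotv mxE; apply: eq_bigr => j _; rewrite mxE. Qed.

Lemma dotvC u v : dotv u v = dotv v u.
Proof. by rewrite !dotvE; apply: eq_bigr => j _; rewrite mulrC. Qed.

Lemma dotvDl u v w : dotv (u + v) w = dotv u w + dotv v w.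
Proof. by rewrite /dotv mulmxDl mxE. Qed.

Lemma dotvDr u v w : dotv u (v + w) = dotv u v + dotv u w.
Proof. by rewrite dotvC dotvDl !(dotvC u). Qed.

Lemma dotvZl a u v : dotv (a *: u) v = a * dotv u v.
Proof. by rewrite /dotv -scalemxAl mxE. Qed.

Lemma dotvZr a u v : dotv u (a *: v) = a * dotv u v.
Proof. by rewrite dotvC dotvZl dotvC. Qed.

Lemma dotvNl u v : dotv (- u) v = - dotv u v.
Proof. by rewrite -scaleN1r dotvZl mulN1r. Qed.

Lemma dotvNr u v : dotv u (- v) = - dotv u v.
Proof. by rewrite dotvC dotvNl dotvC. Qed.

Lemma dotv0l u : dotv 0 u = 0.
Proof. by rewrite /dotv mul0mx mxE. Qed.

Lemma dotv0r u : dotv u 0 = 0.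
Proof. by rewrite dotvC dotv0l. Qed.

Lemma dotv_suml (I : Type) (r : seq I) (Q : pred I) (G : I -> 'rV[R]_d) v :
  dotv (\sum_(i <- r | Q i) G i) v = \sum_(i <- r | Q i) dotv (G i) v.
Proof. by rewrite /dotv mulmx_suml summxE. Qed.

Lemma dotv_sumr (I : Type) (r : seq I) (Q : pred I) (G : I -> 'rV[R]_d) v :
  dotv v (\sum_(i <- r | Q i) G i) = \sum_(i <- r | Q i) dotv v (G i).
Proof. by rewrite dotvC dotv_suml; apply: eq_bigr => i _; rewrite dotvC. Qed.

Definition dotv_linear :=
  (dotvDl, dotvDr, dotvNl, dotvNr, dotvZl, dotvZr, dotv0l, dotv0r).

Lemma sqnorm0 : sqnorm (0 : 'rV[R]_d) = 0.
Proof. exact: dotv0l. Qed.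

Lemma sqnorm_ge0 u : 0 <= sqnorm u.
Proof. by rewrite /sqnorm dotvE sumr_ge0// => j _; rewrite -expr2 sqr_ge0. Qed.

Lemma dotv_young u v : `|dotv u v| <= sqnorm u / 2 + sqnorm v / 2.
Proof.
have := sqnorm_ge0 (u + v); have := sqnorm_ge0 (u - v).
rewrite /sqnorm !dotv_linear (dotvC v u) => h1 h2.
by rewrite ler_norml; apply/andP; split; lra.
Qed.

Lemma sqnormB_le u v :
  sqnorm (u - v) <= 2 * sqnorm u + 2 * sqnorm v.
Proof.
have := sqnorm_ge0 (u + v).
by rewrite /sqnorm !dotv_linear (dotvC v u); lra.
Qed.

End Euclidean.

(** * Gradient inequalities *)

Section GradientInequality.
Context {R : realType} {d : nat}.
Implicit Types (u v x y z : 'rV[R]_d) (h : 'rV[R]_d -> R).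

Lemma dotv_grad h x v : differentiable h x -> dotv (grad h x) v = 'D_v h x.
Proof.
move=> dh; rewrite deriveE// [in RHS](row_sum_delta v) linear_sum dotvE.
apply: eq_bigr => j _; rewrite mxE deriveE// linearZ/=.
by rewrite mulrC.
Qed.

Lemma gradN h x : differentiable h x -> grad (fun z => - h z) x = - grad h x.
Proof.
move=> dh; apply/rowP => i; rewrite !mxE.
by rewrite -[LHS]/('D_(delta_mx 0 i) (- h) x) deriveN//; exact: diff_derivable.
Qed.

(** Convexity of h - (a/2)|.|^2 on the segment from x to y bounds the slope
    of h from x at time t by h y - h x - (a/2)(1 - t)|y - x|^2; the inequality is
    the limit t -> 0+.  The constant a may be negative, so that applying
    the lemma to - h gives the descent lemma. *)
Lemma convex_quadratic_lower_bound h (a : R) x y : differentiable h x ->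
  convex_function setT (fun z => h z - a / 2 * sqnorm z) ->
  h x + dotv (grad h x) (y - x) + a / 2 * sqnorm (y - x) <= h y.
Proof.
move=> dh ch; set v := y - x.
have /diff_derivable -/(_ v) dhv := dh.
have cvgD : (fun t : R => t^-1 *: ((h \o shift x) (t *: v) - h x)) @ 0^'+ -->
    'D_v h x by exact: cvg_dnbhs_at_right.
have cvgR : (fun t : R => h y - h x - a / 2 * (1 - t) * sqnorm v) @ 0^'+ -->
    h y - h x - a / 2 * (1 - 0) * sqnorm v.
  apply: cvg_at_right_filter; apply: cvgB; first exact: cvg_cst.
  apply: cvgM; last exact: cvg_cst.
  apply: cvgM; first exact: cvg_cst.
  by apply: cvgB; [exact: cvg_cst|exact: cvg_id].
suff : 'D_v h x <= h y - h x - a / 2 * (1 - 0) * sqnorm v.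
  by rewrite dotv_grad// subr0 mulr1; lra.
apply: (ler_cvg_to cvgD cvgR); near=> t.
have t0 : 0 < t by near: t; exact: nbhs_right_gt.
have t1 : t < 1 by near: t; exact: nbhs_right_lt.
have t01 : Itv.spec (@Itv.num_sem R) (Itv.Real `[0, 1]%Z) t.
  by rewrite /Itv.num_sem/= realE (ltW t0) /= in_itv/= (ltW t0) (ltW t1).
have := ch (Itv.mk t01) y x; rewrite !in_setT => /(_ isT isT).
rewrite !convRE /= /conv/= /unstable.onem => H.
rewrite /GRing.scale/= ler_pdivrMl//.
have E : t *: y + (1 - t) *: x = t *: v + x.
  by rewrite /v scalerBr scalerBl scale1r; apply/rowP => i; rewrite !mxE; ring.
rewrite E in H.
have : sqnorm (t *: v + x) = t * sqnorm y + (1 - t) * sqnorm x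
    - t * (1 - t) * sqnorm v.
  by rewrite /sqnorm /v !dotv_linear (dotvC x y); ring.
move=> S; rewrite S in H; lra.
Unshelve. all: by end_near. Qed.

End GradientInequality.

(** * Functions pinched between two parabolas *)

Section Pinched.
Context {R : realType} {d : nat}.
Implicit Types (u v x y z : 'rV[R]_d) (h : 'rV[R]_d -> R).

Definition bregman h x y : R := h y - h x - dotv (grad h x) (y - x).

(** The form in which membership in S_{m,l} is used: unlike the convexity
    conditions, two-sided quadratic bounds are visibly stable under averaging. *)
Definition pinched (m l : R) h : Prop := forall x y,
  m / 2 * sqnorm (y - x) <= bregman h x y <= l / 2 * sqnorm (y - x).

Lemma class_S_pinched (m l : R) h : class_S m l h -> pinched m l h.
Proof.
move=> [dh cm cl] x y; rewrite /bregman; apply/andP; split.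
  by have := convex_quadratic_lower_bound y (dh x) cm; lra.
have dNh : differentiable (fun z => - h z) x by exact: differentiableN.
have cNl : convex_function setT (fun z => - h z - (- l) / 2 * sqnorm z).
  rewrite (_ : (fun z => _) = (fun z => - (h z - l / 2 * sqnorm z)))//.
  by apply/funext => z; lra.
have := convex_quadratic_lower_bound y dNh cNl.
by rewrite gradN// dotvNl; lra.
Qed.

Section PinchedTheory.
Variables (m l : R) (h : 'rV[R]_d -> R).
Hypotheses (hml : m <= l) (hp : pinched m l h).

Let H z := h z - m / 2 * sqnorm z.
Let gm := shifted_grad h m.
Let gl := shifted_grad h l.

(** The function H = h - (m/2)|.|^2 lies above its tangent plane at x and
    below a parabola of curvature l - m touching it at y.  Comparing both along
    the ray y - t (gm y - gm x) gives 0 <= D - t |gm y - gm x|^2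
    + (l - m)/2 t^2 |gm y - gm x|^2 for all t, hence the bound; multiplying
    by l - m instead of dividing keeps the case l = m. *)
Lemma pinched_cocoercive x y :
  sqnorm (gm y - gm x) / 2 <= (l - m) * (H y - H x - dotv (gm x) (y - x)).
Proof.
set D := H y - H x - dotv (gm x) (y - x).
set n2 := sqnorm (gm y - gm x).
have key t : 0 <= D - t * n2 + (l - m) / 2 * t ^+ 2 * n2.
  pose w := y - t *: (gm y - gm x).
  have /andP[lo _] := hp x w; have /andP[_ up] := hp y w.
  suff E : bregman h y w - bregman h x w - l / 2 * sqnorm (w - y)
      + m / 2 * sqnorm (w - x) =
    - (D - t * n2 + (l - m) / 2 * t ^+ 2 * n2) by lra.
  rewrite /D /n2 /H /bregman /w.
  have -> : grad h x = gm x + m *: x by rewrite /gm /shifted_grad subrK.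
  have -> : grad h y = gm y + m *: y by rewrite /gm /shifted_grad subrK.
  move: (gm x) (gm y) => p q; rewrite /sqnorm !dotv_linear.
  rewrite (dotvC p q) (dotvC x p) (dotvC y p).
  rewrite (dotvC x q) (dotvC y q) (dotvC x y); by field.
have n20 : 0 <= n2 by exact: sqnorm_ge0.
have [lm0|lm0] := eqVneq (l - m) 0.
  (* H is affine: a linear function of t is bounded below, so n2 = 0 *)
  have [n0|nz] := eqVneq n2 0; first by rewrite n0 lm0; lra.
  have := key ((D + 1) / n2); rewrite lm0 divfK//; lra.
have lm : 0 < l - m by rewrite lt_def lm0 subr_ge0.
have := key (l - m)^-1.
rewrite (_ : _ - _ + _ = (l - m)^-1 * ((l - m) * D - n2 / 2)); last by field.
rewrite pmulr_rge0 ?invr_gt0//; lra.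
Qed.

(** With H = h - (m/2)|.|^2 this is (l - m)(H - H 0) - |grad H|^2 / 2.  Moving
    the squared gradients of the cocoercivity inequality to the function values
    in this way splits it into a term at y and a term at x. *)
Definition energy z : R := (l - m) * (H z - h 0) - sqnorm (gm z) / 2.

Lemma gl_gm z : gl z = gm z - (l - m) *: z.
Proof.
rewrite /gl /gm /shifted_grad scalerBl opprB.
by apply/rowP => i; rewrite !mxE; ring.
Qed.

(** This is cocoercivity rewritten as dissipation: the energy is the storage
    function. *)
Lemma energy_dissipation x y :
  dotv (gm x) (gl x - gl y) <= energy y - energy x.
Proof.
have := pinched_cocoercive x y.
rewrite /energy !gl_gm; move: (gm x) (gm y) => p q.
rewrite /sqnorm !dotv_linear (dotvC q p); lra.
Qed.

(** Cocoercivity in both directions, added up. *)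
Lemma pinched_monotone x y :
  dotv (gm y - gm x) (gl y - gl x) <= 0.
Proof.
have := energy_dissipation x y; have := energy_dissipation y x.
move: (gm x) (gm y) (gl x) (gl y) => p q p' q'.
rewrite !dotv_linear; lra.
Qed.

Lemma pinched_grad_growth x y : 0 < m ->
  sqnorm (grad h y - grad h x) <= (m + l) ^+ 2 * sqnorm (y - x).
Proof.
move=> m0; have l0 := lt_le_trans m0 hml.
have := pinched_monotone x y.
have -> : gm y - gm x = (grad h y - grad h x) - m *: (y - x).
  by rewrite /gm /shifted_grad scalerBr; apply/rowP => i; rewrite !mxE; ring.
have -> : gl y - gl x = (grad h y - grad h x) - l *: (y - x).
  by rewrite /gl /shifted_grad scalerBr; apply/rowP => i; rewrite !mxE; ring.
move: (grad h y - grad h x) (y - x) => u v.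
have := dotv_young u ((m + l) *: v); rewrite ler_norml => /andP[_].
rewrite /sqnorm !dotv_linear (dotvC v u) => h1 h2.
have h3 : 0 <= m * l * dotv v v.
  by rewrite mulr_ge0 ?sqnorm_ge0// mulr_ge0// ltW.
lra.
Qed.

Hypothesis h0 : grad h 0 = 0.

Let gm0 : gm 0 = 0.
Proof. by rewrite /gm /shifted_grad h0 scaler0 subr0. Qed.

Lemma energy0 : energy 0 = 0.
Proof. by rewrite /energy /H gm0 !sqnorm0; lra. Qed.

Lemma energy_ge0 z : 0 <= energy z.
Proof.
have := energy_dissipation 0 z; rewrite gm0 dotv0l energy0; lra.
Qed.

End PinchedTheory.
End Pinched.

(** * Summing the dissipation inequality along a trajectory *)

Section WeightedSum.
Context {R : realType}.

Lemma sum_lag_le (psi : nat -> R) (k n : nat) : (forall t, 0 <= psi t) ->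
  \sum_(t < n) (if (k <= t)%N then psi (t - k)%N else 0) <=
  \sum_(t < n) psi t.
Proof.
move=> psi0.
have -> : \sum_(t < n) (if (k <= t)%N then psi (t - k)%N else 0) =
    \sum_(t < n - k) psi t.
  elim: n => [|n IHn]; first by rewrite !big_ord0.
  rewrite big_ord_recr/= IHn; case: leqP => kn.
    by rewrite subSn// big_ord_recr.
  have /eqP -> : (n.+1 - k == 0)%N by rewrite subn_eq0.
  have /eqP -> : (n - k == 0)%N by rewrite subn_eq0 ltnW.
  by rewrite !big_ord0 addr0.
rewrite -!(big_mkord xpredT) [leRHS](big_cat_nat (n := n - k))//= ?leq_subr//.
by rewrite lerDl sumr_ge0.
Qed.

(** Since rho <= 1 and lambda_k <= 0 for k > 0, each delayed term
    is at most its undelayed version, weighted by rho^-k, plus a change of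
    energy rho^-k phi_t - rho^k phi_(t-k).  The latter telescope with the
    weights rho^(-2t): what is left is a nonpositive boundary term at the
    horizon.  Here a t k stands for g^m_t.g^l_(t-k) and phi t for the energy at
    time t; both count as 0 before time 0. *)
Lemma weighted_dissipation (rho : R) (s tau : nat) (lambda : 'I_s.+1 -> R)
    (phi : nat -> R) (a : nat -> nat -> R) :
  0 < rho -> rho <= 1 ->
  (forall k : 'I_s.+1, (0 < k)%N -> lambda k <= 0) ->
  (forall t, 0 <= phi t) ->
  (forall t, a t 0%N + phi t <= 0) ->
  (forall t k, a t 0%N + phi t
     - (if (k <= t)%N then phi (t - k)%N else 0) <= a t k) ->
  \sum_(t < tau.+1) \sum_(k < s.+1)
      rho ^ (k%:Z - (2 * t)%:Z) * lambda k * a t k <=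
  (\sum_(k < s.+1) rho ^- k * lambda k) *
    \sum_(t < tau.+1) rho ^- (2 * t) * a t 0%N.
Proof.
move=> rho0 rho1 hl phi0 a0 ak.
have rhon0 : rho != 0 by rewrite gt_eqF.
have rhoX n : 0 < rho ^+ n by rewrite exprn_gt0.
have rhoV n : 0 < rho ^- n by rewrite invr_gt0.
pose lag (psi : nat -> R) (t k : nat) :=
  if (k <= t)%N then psi (t - k)%N else 0.
pose psi t := rho ^- (2 * t) * phi t.
have psi0 t : 0 <= psi t by rewrite mulr_ge0// ltW.
have step (t k : nat) (lk : R) : (k = 0%N \/ lk <= 0) ->
  rho ^ (k%:Z - (2 * t)%:Z) * lk * a t k <=
  rho ^- k * lk * (rho ^- (2 * t) * a t 0%N)
  + rho ^- k * lk * (psi t - lag psi t k).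
  move=> hk; rewrite expfzDr// -exprnP -exprnN.
  have lagE : lag psi t k = rho ^+ k * rho ^+ k * rho ^- (2 * t) * lag phi t k.
    rewrite /lag; case: leqP => kt; last by rewrite mulr0.
    rewrite /psi; congr (_ * _); rewrite -exprD addnn -mul2n.
    have -> : (2 * t = 2 * k + 2 * (t - k))%N by rewrite -mulnDr subnKC.
    rewrite (exprD _ (2 * k) (2 * (t - k))) invfM.
    by rewrite [RHS]mulrA divff ?mul1r// gt_eqF.
  rewrite lagE /psi.
  rewrite [leRHS](_ : _ = rho ^- (2 * t) * (rho ^- k * lk * (a t 0%N + phi t)
    - rho ^+ k * lk * lag phi t k)); last first.
    have := gt_eqF (rhoX k); have := gt_eqF (rhoX (2 * t)%N).
    move: (rho ^+ k) (rho ^+ (2 * t)) => r q /negbT q0 /negbT r0.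
    by field; rewrite q0 r0.
  rewrite -!mulrA mulrCA ler_pM2l//.
  case: hk => [k0|lk0].
    have := ak t k; rewrite /lag k0 /= subn0 expr0 invr1; lra.
  have kle : rho ^+ k <= rho ^- k.
    rewrite -[leRHS]mul1r ler_pdivlMr// -exprD exprn_ile1// ltW//.
  have h1 : rho ^+ k * (lk * a t k) <=
      rho ^+ k * (lk * (a t 0%N + phi t - lag phi t k)).
    by rewrite ler_pM2l// ler_wnM2l// ak.
  have h2 : 0 <= (rho ^- k - rho ^+ k) * (lk * (a t 0%N + phi t)).
    by rewrite mulr_ge0 ?subr_ge0// mulr_le0//.
  lra.
have hl' (k : 'I_s.+1) : k = 0%N :> nat \/ lambda k <= 0.
  by have [|/hl] := posnP k; [left|right].
apply: (@le_trans _ _ (\sum_(t < tau.+1) \sum_(k < s.+1)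
  (rho ^- k * lambda k * (rho ^- (2 * t) * a t 0%N)
  + rho ^- k * lambda k * (psi t - lag psi t k)))).
  by apply: ler_sum => t _; apply: ler_sum => k _; exact: step.
rewrite mulr_sumr.
under eq_bigr do rewrite big_split/= -mulr_suml.
rewrite big_split/= gerDl exchange_big/= sumr_le0// => k _.
rewrite -mulr_sumr sumrB.
have [k0|lk0] := hl' k.
  suff -> : \sum_(t < tau.+1) lag psi t k = \sum_(t < tau.+1) psi t.
    by rewrite subrr mulr0.
  by apply: eq_bigr => t _; rewrite /lag k0 subn0.
rewrite mulr_le0_ge0//; last by rewrite subr_ge0 sum_lag_le.
by rewrite mulr_ge0_le0// ltW.
Qed.

End WeightedSum.

(** * Second moments of the two sampling schemes *)

Section Sampling.
Context {R : realType} {N : nat}.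

Section Vectors.
Context {d : nat}.
Implicit Types a : 'I_N -> 'rV[R]_d.

Lemma sqnorm_sum (I : finType) (Q : pred I) (G : I -> 'rV[R]_d) :
  sqnorm (\sum_(i | Q i) G i) =
  \sum_(i | Q i) \sum_(j | Q j) dotv (G i) (G j).
Proof.
by rewrite /sqnorm dotv_suml; apply: eq_bigr => i _; rewrite dotv_sumr.
Qed.

(** Draws at distinct times are uncorrelated: summing over x factorises. *)
Lemma sum_ffun_dotv_neq (b : nat) a (k k' : 'I_b) :
  \sum_i a i = 0 -> k != k' ->
  \sum_(x : {ffun 'I_b -> 'I_N}) dotv (a (x k)) (a (x k')) = 0.
Proof.
move=> a0 kk'; under eq_bigr do rewrite dotvE.
rewrite exchange_big/= big1// => j _.
pose G (q : 'I_b) (i : 'I_N) : R :=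
  if q == k then a i 0 j else if q == k' then a i 0 j else 1.
rewrite (eq_bigr (fun x : {ffun 'I_b -> 'I_N} => \prod_q G q (x q))).
  rewrite -(bigA_distr_bigA G) (bigD1 k)//= /G eqxx.
  by rewrite -summxE a0 mxE mul0r.
move=> x _; rewrite (bigD1 k)//= (bigD1 k')/=; last by rewrite eq_sym.
rewrite /G eqxx (negbTE (_ : k' != k)) 1?eq_sym// eqxx big1 ?mulr1//.
by move=> q /andP[/negbTE -> /negbTE ->].
Qed.

Lemma sum_ffun_at (b : nat) (k : 'I_b) (g : 'I_N -> R) :
  \sum_(x : {ffun 'I_b -> 'I_N}) g (x k) = N%:R ^+ b.-1 * \sum_i g i.
Proof.
pose G (q : 'I_b) (i : 'I_N) : R := if q == k then g i else 1.
rewrite (eq_bigr (fun x : {ffun 'I_b -> 'I_N} => \prod_q G q (x q))).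
  rewrite -(bigA_distr_bigA G) (bigD1 k)//= /G eqxx mulrC; congr (_ * _).
  rewrite (eq_bigr (fun=> N%:R)); last first.
    by move=> q /negbTE ->; rewrite sumr_const card_ord.
  by rewrite prodr_const cardC1 card_ord.
move=> x _; rewrite (bigD1 k)//= /G eqxx big1 ?mulr1//.
by move=> q /negbTE ->.
Qed.

Lemma sum_ffun_sqnorm (b : nat) a : \sum_i a i = 0 ->
  \sum_(x : {ffun 'I_b -> 'I_N}) sqnorm (\sum_k a (x k)) =
  b%:R * N%:R ^+ b.-1 * \sum_i sqnorm (a i).
Proof.
move=> a0; under eq_bigr do rewrite sqnorm_sum.
rewrite exchange_big/= (eq_bigr (fun=> N%:R ^+ b.-1 * \sum_i sqnorm (a i))).
  by rewrite sumr_const card_ord -[LHS]mulr_natl mulrA.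
move=> k _; rewrite exchange_big/= (bigD1 k)//= (sum_ffun_at k (sqnorm \o a)).
rewrite [X in _ + X]big1 ?addr0// => k' kk'.
by rewrite sum_ffun_dotv_neq// eq_sym.
Qed.

(** Counts of b-subsets through given indices, kept as real sums of indicators
    so that double counting is an exchange of sums. *)
Let n1 (b : nat) (i : 'I_N) : R :=
  \sum_(S : {set 'I_N} | #|S| == b) (i \in S)%:R.
Let n2 (b : nat) (i j : 'I_N) : R :=
  \sum_(S : {set 'I_N} | #|S| == b) (i \in S)%:R * (j \in S)%:R.

Let n2_perm (b : nat) (s : {perm 'I_N}) (i j : 'I_N) :
  n2 b (s i) (s j) = n2 b i j.
Proof.
have imK (t t' : {perm 'I_N}) : cancel t t' ->
    cancel (fun S : {set 'I_N} => t @: S) (fun S => t' @: S).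
  move=> tt' S; rewrite -imset_comp -[RHS]imset_id.
  by apply: eq_imset => x /=; rewrite tt'.
rewrite /n2 (reindex (fun S : {set 'I_N} => s @: S))/=; last first.
  exists (fun S : {set 'I_N} => s^-1%g @: S) => S _.
    by apply: imK => x; rewrite permK.
  by apply: imK => x; rewrite permKV.
apply: eq_big => S; first by rewrite card_imset//; exact: perm_inj.
by move=> _; rewrite !mem_imset//; exact: perm_inj.
Qed.

Let n1E (b : nat) (i : 'I_N) : n1 b i = n2 b i i.
Proof.
apply: eq_bigr => S _; case: (i \in S); last by rewrite mul0r.
by rewrite mulr1.
Qed.

Let n1_sum (b : nat) (i : 'I_N) : N%:R * n1 b i = b%:R * 'C(N, b)%:R.
Proof.
have -> : N%:R * n1 b i = \sum_j n1 b j.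
  rewrite (eq_bigr (fun=> n1 b i)); last first.
    by move=> j _; rewrite !n1E -(n2_perm b (tperm i j)) tpermR.
  by rewrite sumr_const card_ord mulr_natl.
rewrite /n1 exchange_big/= (eq_bigr (fun=> b%:R)); last first.
  by move=> S /eqP <-; rewrite -sum1_card natr_sum [RHS]big_mkcond/=;
    apply: eq_bigr => j _; case: (j \in S).
rewrite sumr_const -[X in 'C(X, b)](card_ord N) -card_draws -[LHS]mulr_natr.
by congr (_ * (_)%:R); apply: eq_card => S; rewrite !inE.
Qed.

Let n2_sum (b : nat) (i j : 'I_N) : i != j ->
  (N%:R - 1) * n2 b i j = (b%:R - 1) * n1 b i.
Proof.
move=> ij.
have -> : (N%:R - 1) * n2 b i j = \sum_j' n2 b i j' - n1 b i.
  rewrite (bigD1 i)//= -n1E addrAC subrr add0r.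
  rewrite (eq_bigr (fun=> n2 b i j)); last first.
    move=> j' ij'; rewrite -(n2_perm b (tperm j j')) tpermR tpermD//.
    by rewrite eq_sym.
  rewrite sumr_const cardC1 card_ord -subn1 -[RHS]mulr_natl natrB//.
  exact: leq_ltn_trans (ltn_ord i).
rewrite mulrBl mul1r; congr (_ - _).
rewrite /n2 /n1 exchange_big/= mulr_sumr; apply: eq_bigr => S /eqP Sb.
rewrite -mulr_sumr mulrC; congr (_ * _).
by rewrite -Sb -sum1_card natr_sum [RHS]big_mkcond/=;
  apply: eq_bigr => j' _; case: (j' \in S).
Qed.

(** By symmetry the two-point counts take one value on the diagonal and one
    off it; since the a_i sum to zero only their difference matters. *)
Lemma sum_subset_sqnorm (b : nat) a : (1 < N)%N -> \sum_i a i = 0 ->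
  \sum_(S : {set 'I_N} | #|S| == b) sqnorm (\sum_(i in S) a i) =
  'C(N, b)%:R * b%:R * (N%:R - b%:R) / (N%:R * (N%:R - 1)) *
    \sum_i sqnorm (a i).
Proof.
move=> N1 a0.
have N0 : N%:R != 0 :> R by rewrite pnatr_eq0 -lt0n ltnW.
have N10 : N%:R - 1 != 0 :> R by rewrite subr_eq0 pnatr_eq1 gtn_eqF.
pose p1 : R := b%:R * 'C(N, b)%:R / N%:R.
pose p2 : R := (b%:R - 1) * p1 / (N%:R - 1).
have n1p i : n1 b i = p1 by rewrite /p1 -(n1_sum b i) mulrAC divff ?mul1r.
have n2p i j : i != j -> n2 b i j = p2.
  by move=> ij; rewrite /p2 -(n1p i) -(n2_sum b ij) mulrAC divff ?mul1r.
transitivity (\sum_i \sum_j n2 b i j * dotv (a i) (a j)).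
  transitivity (\sum_(S : {set 'I_N} | #|S| == b) \sum_i \sum_j
      (i \in S)%:R * (j \in S)%:R * dotv (a i) (a j)).
    apply: eq_bigr => S _; rewrite sqnorm_sum big_mkcond/=.
    apply: eq_bigr => i _; case: (i \in S).
      rewrite big_mkcond/=; apply: eq_bigr => j _.
      by case: (j \in S); rewrite mul1r ?mul1r ?mul0r.
    by rewrite big1// => j _; rewrite !mul0r.
  rewrite exchange_big/=; apply: eq_bigr => i _.
  by rewrite exchange_big/=; apply: eq_bigr => j _; rewrite mulr_suml.
have rowE i : \sum_j n2 b i j * dotv (a i) (a j) = (p1 - p2) * sqnorm (a i).
  transitivity (p2 * dotv (a i) (\sum_j a j) + (p1 - p2) * sqnorm (a i)).
    rewrite dotv_sumr mulr_sumr (bigD1 i)//= [in RHS](bigD1 i)//=.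
    rewrite -n1E n1p (eq_bigr (fun j => p2 * dotv (a i) (a j))).
      by rewrite /sqnorm; ring.
    by move=> j ij; rewrite n2p// eq_sym.
  by rewrite a0 dotv0r mulr0 add0r.
under eq_bigr do rewrite rowE.
rewrite -mulr_sumr; congr (_ * _); rewrite /p2 /p1.
by field; rewrite N0 N10.
Qed.

End Vectors.

End Sampling.

(** * Averages and the noise of a mini-batch *)

Section Average.
Context {R : realType} {d N : nat}.
Variables (m l : R) (f : 'I_N -> 'rV[R]_d -> R).
Hypotheses (hN : (0 < N)%N) (hml : m <= l).
Hypothesis df : forall i z, differentiable (f i) z.

Let N0 : N%:R != 0 :> R. Proof. by rewrite pnatr_eq0 -lt0n. Qed.

Lemma grad_avg z : grad (avg_fun f) z = N%:R^-1 *: \sum_i grad (f i) z.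
Proof.
apply/rowP => j; rewrite !mxE summxE.
have dij i : derivable (f i) z (delta_mx 0 j) by exact: diff_derivable.
rewrite (_ : avg_fun f = N%:R^-1 *: \sum_i f i); last first.
  by apply/funext => x; rewrite /avg_fun [RHS]/GRing.scale/= fct_sumE.
rewrite deriveZ; last exact: derivable_sum.
rewrite derive_sum// [LHS]/GRing.scale/=; congr (_ * _).
by apply: eq_bigr => i _; rewrite mxE.
Qed.

Hypothesis hp : forall i, pinched m l (f i).

Lemma avg_pinched : pinched m l (avg_fun f).
Proof.
move=> x y.
have -> : bregman (avg_fun f) x y = N%:R^-1 * \sum_i bregman (f i) x y.
  rewrite /bregman /avg_fun grad_avg dotvZl dotv_suml -!mulrBr; congr (_ * _).
  by rewrite !sumrB.
have sumN (c : R) : c = N%:R^-1 * \sum_(i < N) c.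
  by rewrite sumr_const card_ord -[X in _ * X]mulr_natl mulrA mulVf ?mul1r.
rewrite [X in X <= _](sumN) [X in _ && (_ <= X)](sumN).
by rewrite !ler_pM2l ?invr_gt0 ?ltr0n//; apply/andP; split;
  apply: ler_sum => i _; have /andP[] := hp i x y.
Qed.

Definition deviation z (i : 'I_N) : 'rV[R]_d :=
  grad (f i) z - grad (f i) 0 - grad (avg_fun f) z.

Lemma batch_noise_seq (b : nat) (s : seq 'I_N) z : (0 < b)%N -> size s = b ->
  batch_noise f b (seq_mset s) z = b%:R^-1 *: \sum_(i <- s) deviation z i.
Proof.
move=> b0 sb.
have b0R : b%:R != 0 :> R by rewrite pnatr_eq0 -lt0n.
rewrite /batch_noise /batch_grad !(perm_big _ (perm_eq_seq_mset s))/=.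
have sumc (v : 'rV[R]_d) : \sum_(i <- s) v = b%:R *: v.
  by rewrite big_const_seq count_predT sb iter_addr_0 scaler_nat.
rewrite /deviation !sumrB !scalerBr sumc scalerA mulVf// scale1r.
by rewrite addrAC.
Qed.

Hypothesis hf0 : grad (avg_fun f) 0 = 0.

Lemma sum_deviation z : \sum_i deviation z i = 0.
Proof.
have gE x : \sum_i grad (f i) x = N%:R *: grad (avg_fun f) x.
  by rewrite grad_avg scalerA divff// scale1r.
rewrite /deviation !sumrB !gE hf0 scaler0 subr0 sumr_const card_ord.
by rewrite scaler_nat subrr.
Qed.

(** With u_i the increment of the i-th gradient, the left-hand side is
    the mean of (u_i - m z).(u_i - l z), and each term is nonpositive because
    f_i is itself pinched: the slack is exactly the variance of the u_i. *)
Lemma deviation_budget z :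
  dotv (shifted_grad (avg_fun f) m z) (shifted_grad (avg_fun f) l z)
  + N%:R^-1 * \sum_i sqnorm (deviation z i) <= 0.
Proof.
pose u i := grad (f i) z - grad (f i) 0.
have uE : N%:R^-1 *: \sum_i u i = grad (avg_fun f) z.
  by rewrite /u sumrB scalerBr -!grad_avg hf0 subr0.
set g := grad (avg_fun f) z in uE *.
have term i : dotv (u i - m *: z) (u i - l *: z) <= 0.
  have := pinched_monotone hml (hp i) 0 z.
  by rewrite /shifted_grad !scaler0 !subr0 -!(addrAC _ (- grad (f i) 0)).
have meanu (v : 'rV[R]_d) : N%:R^-1 * \sum_i dotv (u i) v = dotv g v.
  by rewrite -uE dotvZl dotv_suml.
have meanc (c : R) : N%:R^-1 * \sum_(i < N) c = c.
  by rewrite sumr_const card_ord -[X in _ * X]mulr_natl mulrA mulVf ?mul1r.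
have : N%:R^-1 * \sum_i dotv (u i - m *: z) (u i - l *: z) <= 0.
  by rewrite mulr_ge0_le0 ?invr_ge0// sumr_le0.
have -> : \sum_i dotv (u i - m *: z) (u i - l *: z) =
    \sum_i (sqnorm (u i) - (m + l) * dotv (u i) z + m * l * sqnorm z).
  apply: eq_bigr => i _; move: (u i) => v.
  by rewrite /sqnorm !dotv_linear (dotvC z v); ring.
have -> : \sum_i sqnorm (deviation z i) =
    \sum_i (sqnorm (u i) - 2 * dotv (u i) g + sqnorm g).
  apply: eq_bigr => i _; rewrite /deviation -/g -/(u i).
  by move: (u i) (g) => v g'; rewrite /sqnorm !dotv_linear (dotvC g' v); ring.
rewrite !big_split/= !sumrN -!mulr_sumr !mulrDr !mulrN !(mulrCA N%:R^-1).
rewrite !meanu !meanc /shifted_grad -/g.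
move: (g) => g'.
by rewrite /sqnorm !dotv_linear (dotvC z g'); lra.
Qed.

Hypothesis hm : 0 < m.

Lemma shifted_grad_growth (c : R) : exists K, forall z,
  sqnorm (shifted_grad (avg_fun f) c z) <= K * sqnorm z.
Proof.
exists (2 * (m + l) ^+ 2 + 2 * c ^+ 2) => z.
have := pinched_grad_growth hml avg_pinched 0 z hm.
rewrite hf0 !subr0 => h1.
apply: (le_trans (sqnormB_le _ _)).
rewrite [sqnorm (c *: z)]/sqnorm !dotv_linear -/(sqnorm z); lra.
Qed.

Lemma deviation_growth : exists K, forall z,
  N%:R^-1 * \sum_i sqnorm (deviation z i) <= K * sqnorm z.
Proof.
have [Km hKm] := shifted_grad_growth m; have [Kl hKl] := shifted_grad_growth l.
exists (Km / 2 + Kl / 2) => z.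
have := deviation_budget z; have := dotv_young
  (shifted_grad (avg_fun f) m z) (shifted_grad (avg_fun f) l z).
have := hKm z; have := hKl z.
by rewrite ler_norml => h1 h2 /andP[h3 _] h4; lra.
Qed.

End Average.

(** * Independence of the mini-batch from the past *)

Section Independence.
Context {disp : measure_display} {T : measurableType disp} {R : realType}.
Variable P : probability T R.
Implicit Types (G : set (set T)) (A : set T).

Lemma borel_measurable_comp (V : topologicalType) G (X : T -> V)
    (phi : V -> R) :
  sigma_algebra setT G -> borel_measurable_wrt G X -> continuous phi ->
  forall Y, measurable Y -> G ((phi \o X) @^-1` Y).
Proof.
move=> sG mX /continuousP cphi Y.
rewrite -[measurable Y]/((@ocitv R).-sigma.-measurable Y).
rewrite RGenOpens.measurableE => mY.
suff : image_set_system setT (phi \o X) G Y.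
  by rewrite /image_set_system/= setTI.
move: Y mY; apply: smallest_sub; first exact: sigma_algebra_image.
move=> _ [a [c ->]].
rewrite /image_set_system/=; apply: mX; rewrite comp_preimage.
exists (phi @^-1` `]a, c[) => //; apply: sub_sigma_algebra.
exact/cphi/interval_open.
Qed.

(** Both sides are integrals of tail probabilities, and the product rule
    holds for each tail event. *)
Lemma independent_expectation G A (X : T -> R) :
  G `<=` measurable -> measurable A ->
  (forall C, G C -> P (A `&` C) = (P A * P C)%E) ->
  (forall Y, measurable Y -> G (X @^-1` Y)) -> (forall w, 0 <= X w) ->
  ('E_P[fun w => (\1_A w * X w)%R] = P A * 'E_P[X])%E.
Proof.
move=> Gm mA indA GX X0.
have mX : measurable_fun setT X by move=> _ Y mY; rewrite setTI; exact/Gm/GX.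
have mAX : measurable_fun setT (fun w => \1_A w * X w).
  by apply: measurable_funM => //; exact: measurable_indic.
pose X' : {RV P >-> R} := HB.pack X (isMeasurableFun.Build _ _ _ _ _ mX).
pose AX' : {RV P >-> R} := HB.pack (fun w => \1_A w * X w)
  (isMeasurableFun.Build _ _ _ _ _ mAX).
change ('E_P[AX'] = P A * 'E_P[X'])%E.
rewrite !ge0_expectation_ccdf//; last by move=> w; rewrite /= mulr_ge0.
rewrite -[P A]fineK ?fin_num_measure// -ge0_integralZl_EFin//; last 2 first.
- by apply: (measurable_funS measurableT) => //; exact: ccdf_measurable.
- by rewrite fine_ge0.
apply: eq_integral => r; rewrite inE/= in_itv/= andbT => r0.
rewrite fineK ?fin_num_measure//.
rewrite /ccdf /distribution /pushforward/= -indA; last exact/GX.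
congr (P _); apply/seteqP; split => w /=; rewrite !in_itv/= !andbT indicE.
  case: (boolP (w \in A)) => wA; first by rewrite mul1r inE in wA *.
  by rewrite mul0r ltNge r0.
by case=> wA; rewrite mem_set// mul1r.
Qed.

End Independence.

(** * Averaging over a finitely supported variable *)

Section Expectation.
Context {disp : measure_display} {T : measurableType disp} {R : realType}.
Variable P : probability T R.

Lemma eq_expectation (X Y : T -> R) : X =1 Y -> ('E_P[X] = 'E_P[Y])%E.
Proof. by move=> /funext ->. Qed.

Lemma ge0_expectation_sum (I : Type) (s : seq I) (Q : pred I)
    (X : I -> T -> R) :
  (forall i, measurable_fun setT (X i)) -> (forall i w, 0 <= X i w) ->
  ('E_P[fun w => (\sum_(i <- s | Q i) X i w)%R] =
   \sum_(i <- s | Q i) 'E_P[X i])%E.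
Proof.
move=> mX X0; rewrite unlock -[RHS]big_filter.
rewrite -ge0_integral_sum//.
- by apply: eq_integral => w _; rewrite sumEFin big_filter.
- by move=> i; exact/measurable_EFinP.
- by move=> i w _; rewrite lee_fin.
Qed.

Lemma ge0_expectationZl (k : R) (X : T -> R) : 0 <= k ->
  measurable_fun setT X -> (forall w, 0 <= X w) ->
  ('E_P[fun w => (k * X w)%R] = k%:E * 'E_P[X])%E.
Proof.
move=> k0 mX X0; rewrite unlock -ge0_integralZl_EFin//.
  by move=> w _; rewrite lee_fin.
exact/measurable_EFinP.
Qed.

Section Mixture.
Variables (V : countType) (B : T -> V) (G : V -> T -> R).
Hypotheses (mB : forall C : set V, measurable (B @^-1` C))
  (mG : forall S, measurable_fun setT (G S)) (G0 : forall S w, 0 <= G S w).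

(** The values of B are countable, so that a preimage under w |-> G (B w) w is
    a countable union of events. *)
Lemma measurable_fun_selection : measurable_fun setT (fun w => G (B w) w).
Proof.
move=> _ Y mY; rewrite setTI.
rewrite (_ : _ @^-1` Y = \bigcup_n (if choice.unpickle n is Some v
    then B @^-1` [set v] `&` G v @^-1` Y else set0)); last first.
  apply/seteqP; split => [w Yw|w [n _]].
    by exists (choice.pickle (B w)) => //; rewrite choice.pickleK.
  by case: (choice.unpickle n) => //= S [<-].
apply: bigcupT_measurable => n; case: (choice.unpickle n) => // S.
by apply: measurableI; [exact: mB|rewrite -[X in measurable X]setTI; exact: mG].
Qed.

(** The finitely many values charged by the law exhaust the probability, so
    the expectation splits over them. *)
Lemma expectation_finite_law (I : finType) (Q : pred I) (beta : I -> V)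
    (p : I -> R) :
  (forall S, 'E_P[fun w => (\1_(B @^-1` [set S]) w * G S w)%R] =
    P (B @^-1` [set S]) * 'E_P[G S])%E ->
  (forall x, 0 <= p x) -> \sum_(x | Q x) p x = 1 ->
  (forall x, Q x -> P (B @^-1` [set beta x]) =
    (\sum_(y | Q y && (beta y == beta x)) p y)%:E) ->
  ('E_P[fun w => G (B w) w] = \sum_(x | Q x) (p x)%:E * 'E_P[G (beta x)])%E.
Proof.
move=> ind p0 p1 law.
pose vals := undup [seq beta x | x <- enum Q].
have valsP S : S \in vals -> exists2 x, Q x & S = beta x.
  by rewrite mem_undup => /mapP[x]; rewrite mem_enum => Qx ->; exists x.
have regroup (W : nmodType) (F : I -> W) :
    \sum_(S <- vals) \sum_(y | Q y && (beta y == S)) F y = \sum_(y | Q y) F y.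
  under eq_bigr do rewrite big_mkcondr/=.
  rewrite exchange_big/=; apply: eq_bigr => y Qy.
  rewrite (bigD1_seq (beta y))/= ?undup_uniq ?eqxx//; last first.
    by rewrite mem_undup map_f// mem_enum.
  by rewrite big1 ?addr0// => S /negbTE; rewrite eq_sym => ->.
have lawS S : S \in vals -> P (B @^-1` [set S]) =
    (\sum_(y | Q y && (beta y == S)) p y)%:E.
  by move=> /valsP[x Qx ->]; exact: law.
have sum1 w : \sum_(S <- vals) \1_(B @^-1` [set S]) w = (B w \in vals)%:R :> R.
  have [Bv|Bv] := boolP (B w \in vals).
    rewrite (bigD1_seq (B w))/= ?undup_uniq// indicE mem_set// big1 ?addr0//.
    by move=> S SB; rewrite indicE memNset//= => BS; rewrite BS eqxx in SB.
  rewrite big_seq big1// => S Sv; rewrite indicE memNset//= => BS.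
  by rewrite BS Sv in Bv.
have sumG w : B w \in vals ->
    \sum_(S <- vals) \1_(B @^-1` [set S]) w * G S w = G (B w) w.
  move=> Bv; rewrite (bigD1_seq (B w))/= ?undup_uniq// indicE mem_set//.
  rewrite mul1r big1 ?addr0// => S SB.
  by rewrite indicE memNset ?mul0r//= => BS; rewrite BS eqxx in SB.
pose D := B @^-1` [set S | S \in vals].
have mI S : measurable_fun setT (\1_(B @^-1` [set S]) : T -> R).
  exact: measurable_indic.
have mIG S : measurable_fun setT (fun w => \1_(B @^-1` [set S]) w * G S w).
  exact: measurable_funM.
have PD : P D = 1%E.
  rewrite -(@expectation_indic _ _ _ P)//; last exact: mB.
  rewrite -[RHS](_ : (\sum_(x | Q x) p x)%:E = _); last by rewrite p1.
  rewrite -regroup -sumEFin.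
  rewrite (eq_expectation (Y := fun w =>
      \sum_(S <- vals) \1_(B @^-1` [set S]) w)); last first.
    move=> w; rewrite sum1 indicE; case: (boolP (B w \in vals)) => Bv.
      by rewrite mem_set.
    by rewrite memNset//; exact/negP.
  rewrite ge0_expectation_sum//.
  rewrite big_seq [RHS]big_seq; apply: eq_bigr => S Sv.
  by rewrite expectation_indic// lawS.
transitivity ('E_P[fun w =>
    (\sum_(S <- vals) \1_(B @^-1` [set S]) w * G S w)%R])%E.
  rewrite unlock; apply: ge0_ae_eq_integral => //.
  - exact/measurable_EFinP/measurable_fun_selection.
  - exact/measurable_EFinP/measurable_sum.
  - by move=> w _; rewrite lee_fin.
  - by move=> w _; rewrite lee_fin sumr_ge0// => S _; rewrite mulr_ge0.
  have PDC : P (~` D) = 0%E.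
    by rewrite probability_setC ?PD ?subee//; exact: mB.
  exists (~` D); split; [exact/measurableC/mB|exact: PDC|].
  move=> w /= nw Dw; apply: nw => _; congr (_%:E); exact/esym/sumG.
rewrite ge0_expectation_sum//; last by move=> S w; rewrite mulr_ge0.
rewrite -[RHS](regroup (\bar R)).
rewrite big_seq [RHS]big_seq; apply: eq_bigr => S Sv.
rewrite ind lawS// -sumEFin ge0_sume_distrl; last by move=> y _; rewrite lee_fin.
by apply: eq_bigr => y /andP[_ /eqP ->].
Qed.

End Mixture.
End Expectation.

(** * Continuity of the gradients *)

Section Continuity.
Context {R : realType} {d : nat}.
Implicit Types (u v : 'rV[R]_d -> 'rV[R]_d).

Definition coord_cont u := forall j, continuous (fun z => u z 0 j).

Lemma continuous_sumr (I : Type) (s : seq I) (Q : pred I)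
    (g : I -> 'rV[R]_d -> R) : (forall i, continuous (g i)) ->
  continuous (fun z => \sum_(i <- s | Q i) g i z).
Proof.
move=> cg; elim: s => [|i s IH] z.
  rewrite (_ : (fun _ => _) = cst 0); first exact: cst_continuous.
  by apply/funext => y; rewrite big_nil.
case Qi : (Q i); last first.
  rewrite (_ : (fun _ => _) = fun z => \sum_(i <- s | Q i) g i z).
    exact: IH.
  by apply/funext => y; rewrite big_cons Qi.
rewrite (_ : (fun _ => _) = fun z => g i z + \sum_(i <- s | Q i) g i z).
  exact: (continuousD (cg i z) (IH z)).
by apply/funext => y; rewrite big_cons Qi.
Qed.

Lemma coord_contB u v : coord_cont u -> coord_cont v ->
  coord_cont (fun z => u z - v z).
Proof.
move=> cu cv j z.
rewrite (_ : (fun _ => _) = fun z => u z 0 j - v z 0 j).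
  exact: (continuousB (cu j z) (cv j z)).
by apply/funext => y; rewrite !mxE.
Qed.

Lemma coord_contZ (c : R) u : coord_cont u -> coord_cont (fun z => c *: u z).
Proof.
move=> cu j z; rewrite (_ : (fun _ => _) = fun z => c * u z 0 j).
  exact: (continuousM (@cst_continuous _ _ c z) (cu j z)).
by apply/funext => y; rewrite !mxE.
Qed.

Lemma coord_cont_sum (I : Type) (s : seq I) (u : I -> 'rV[R]_d -> 'rV[R]_d) :
  (forall i, coord_cont (u i)) -> coord_cont (fun z => \sum_(i <- s) u i z).
Proof.
move=> cu j; rewrite (_ : (fun _ => _) = fun z => \sum_(i <- s) u i z 0 j).
  by apply: continuous_sumr => i; exact: cu.
by apply/funext => y; rewrite summxE.
Qed.

Lemma coord_cont_cst (c : 'rV[R]_d) : coord_cont (fun=> c).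
Proof. by move=> j z; exact: (@cst_continuous _ _ (c 0 j) z). Qed.

Lemma coord_cont_id : coord_cont id.
Proof. by move=> j; exact: coord_continuous. Qed.

Lemma continuous_dotv u v : coord_cont u -> coord_cont v ->
  continuous (fun z => dotv (u z) (v z)).
Proof.
move=> cu cv; rewrite (_ : (fun _ => _) = fun z => \sum_j u z 0 j * v z 0 j).
  apply: continuous_sumr => j z.
  exact: (continuousM (cu j z) (cv j z)).
by apply/funext => y; rewrite dotvE.
Qed.

(** The topology is that of the sup norm; it is compared with the Euclidean
    one through the continuity of z |-> |z - x|^2. *)
Lemma coord_cont_lipschitz (K : R) u : 0 <= K ->
  (forall x y, sqnorm (u y - u x) <= K * sqnorm (y - x)) -> coord_cont u.
Proof.
move=> K0 lip j x; have FFx := nbhs_filter x.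
apply/cvgrPdist_lt => e e0.
have cK : (fun z => K * sqnorm (z - x)) @ x --> K * sqnorm (x - x).
  apply: cvgM; first exact: cvg_cst.
  apply: (continuous_dotv (u := fun z => z - x) (v := fun z => z - x)).
    by apply: coord_contB; [exact: coord_cont_id|exact: coord_cont_cst].
  by apply: coord_contB; [exact: coord_cont_id|exact: coord_cont_cst].
have : \forall z \near x, K * sqnorm (z - x) < e ^+ 2.
  by apply: (cvgr_lt _ cK); rewrite subrr sqnorm0 mulr0 exprn_gt0.
apply: filterS => z Kz.
rewrite -(ltr_pXn2r (n := 2))// ?nnegrE ?(ltW e0)//.
rewrite real_normK ?num_real// (le_lt_trans _ Kz)//.
rewrite (le_trans _ (lip x z))// /sqnorm dotvE (bigD1 j)//= !mxE.
rewrite -expr2 -sqrrN opprB lerDl sumr_ge0// => i _.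
by rewrite -expr2 sqr_ge0.
Qed.

Lemma pinched_grad_cont (m l : R) (h : 'rV[R]_d -> R) : 0 < m -> m <= l ->
  pinched m l h -> coord_cont (grad h).
Proof.
move=> m0 ml hp; apply: (@coord_cont_lipschitz ((m + l) ^+ 2)).
  exact: sqr_ge0.
by move=> x y; exact: pinched_grad_growth.
Qed.

End Continuity.

(** * Second moment of the noise *)

Section Noise.
Context {disp : measure_display} {T : measurableType disp} {R : realType}.
Variable P : probability T R.
Context {d N b : nat}.
Implicit Types (B : T -> {mset 'I_N}%mset).

Definition mset_of_draws (x : {ffun 'I_b -> 'I_N}) : {mset 'I_N}%mset :=
  seq_mset [seq x k | k <- enum 'I_b].

(** A multiset arises from all the orderings of its elements as a sequence of
    draws, whence a sum over a fibre. *)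
Lemma with_replacement_law B :
  (forall C, measurable (B @^-1` C)) -> sampled_by P with_replacement b B ->
  forall S, P (B @^-1` [set S]) =
    (\sum_(x : {ffun 'I_b -> 'I_N} | mset_of_draws x == S) N%:R ^- b)%:E.
Proof.
move=> mB [xi [mxi ind unif Bxi]] S.
pose E (x : {ffun 'I_b -> 'I_N}) :=
  \bigcap_(k in [set` enum 'I_b]) (xi k @^-1` [set x k]).
have mE x : measurable (E x).
  apply: fin_bigcap_measurable => [|k _]; first exact: finite_seq.
  by apply: mxi; exists [set x k] => //; rewrite setTI.
have PE x : P (E x) = (N%:R ^- b)%:E.
  rewrite /E ind ?enum_uniq//; under eq_bigr do rewrite unif.
  rewrite prodEFin; congr (_%:E).
  by rewrite big_const_seq count_predT -cardE card_ord iter_mulr_1 exprVn.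
rewrite -(@expectation_indic _ _ _ P)// -sumEFin.
transitivity ('E_P[fun w =>
    (\sum_(x : {ffun 'I_b -> 'I_N} | mset_of_draws x == S) \1_(E x) w)%R])%E;
  last first.
  rewrite ge0_expectation_sum//; last by move=> x; exact: measurable_indic.
  by apply: eq_bigr => x _; rewrite expectation_indic// PE.
apply: eq_expectation.
move=> w; pose xw : {ffun 'I_b -> 'I_N} := [ffun k => xi k w].
have Bw : B w = mset_of_draws xw.
  rewrite Bxi /mset_of_draws; congr seq_mset.
  by apply: eq_map => k; rewrite ffunE.
have indE x : \1_(E x) w = (x == xw)%:R :> R.
  have [->|xxw] := eqVneq x xw.
    by rewrite indicE mem_set// => k _ /=; rewrite ffunE.
  rewrite indicE memNset// => Exw; move/eqP: xxw; apply; apply/ffunP => k.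
  by rewrite ffunE; apply/esym/Exw; rewrite /= mem_enum.
rewrite indicE; under eq_bigr do rewrite indE.
have [BS|BS] := eqVneq (mset_of_draws xw) S.
  rewrite mem_set/= ?Bw// (bigD1 xw) ?BS//= eqxx big1 ?addr0//.
  by move=> x /andP[_ /negbTE ->].
rewrite memNset/= ?Bw//; last exact/eqP.
rewrite big1// => x /eqP xS; case: eqVneq => // xxw.
by rewrite -xxw xS eqxx in BS.
Qed.

End Noise.

Section NoiseMoment.
Context {disp : measure_display} {T : measurableType disp} {R : realType}.
Variable P : probability T R.
Context {d N b : nat}.
Variables (m l : R) (f : 'I_N -> 'rV[R]_d -> R).
Hypotheses (hN : (0 < N)%N) (hb : (0 < b)%N) (hm : 0 < m) (hml : m <= l).
Hypothesis df : forall i z, differentiable (f i) z.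
Hypothesis hp : forall i, pinched m l (f i).
Hypothesis hf0 : grad (avg_fun f) 0 = 0.

Let grad_cont i : coord_cont (grad (f i)).
Proof. exact: pinched_grad_cont hml (hp i). Qed.

Lemma avg_grad_cont : coord_cont (grad (avg_fun f)).
Proof. exact: pinched_grad_cont hml (avg_pinched hN df hp). Qed.

Lemma shifted_grad_cont (c : R) : coord_cont (shifted_grad (avg_fun f) c).
Proof.
apply: coord_contB; first exact: avg_grad_cont.
by apply: coord_contZ; exact: coord_cont_id.
Qed.

Lemma deviation_cont i : coord_cont (fun x => deviation f x i).
Proof.
apply: coord_contB; last exact: avg_grad_cont.
by apply: coord_contB; [exact: grad_cont|exact: coord_cont_cst].
Qed.

Lemma batch_noise_cont S : coord_cont (batch_noise f b S).
Proof.
apply: coord_contB; last exact: coord_cont_cst.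
apply: coord_contB; last exact: avg_grad_cont.
by apply: coord_contZ; apply: coord_cont_sum => i; exact: grad_cont.
Qed.

Definition spread (x : 'rV[R]_d) : R :=
  N%:R^-1 * \sum_i sqnorm (deviation f x i).

Lemma spread_ge0 x : 0 <= spread x.
Proof. by rewrite mulr_ge0 ?invr_ge0// sumr_ge0// => i _; exact: sqnorm_ge0. Qed.

Section OneStep.
Variables (G : set (set T)) (z : T -> 'rV[R]_d) (B : T -> {mset 'I_N}%mset).
Hypotheses (sG : sigma_algebra setT G) (Gm : G `<=` measurable)
  (mB : forall C, measurable (B @^-1` C)) (mz : borel_measurable_wrt G z)
  (ind : independent_systems P (preimage_set_system setT B setT) G).

Lemma measurable_continuous_comp (phi : 'rV[R]_d -> R) : continuous phi ->
  measurable_fun setT (phi \o z).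
Proof.
move=> cphi _ Y mY; rewrite setTI; apply: Gm.
exact: borel_measurable_comp sG mz cphi _ mY.
Qed.

Lemma noise_cont S : continuous (fun x => sqnorm (batch_noise f b S x)).
Proof. by apply: continuous_dotv; exact: batch_noise_cont. Qed.

(** By independence the mini-batch may be averaged out at a frozen point. *)
Lemma expectation_frozen (I : finType) (Q : pred I)
    (beta : I -> {mset 'I_N}%mset) (p : I -> R) (v : 'rV[R]_d -> R) :
  (forall x, 0 <= p x) -> \sum_(x | Q x) p x = 1 ->
  (forall x, Q x -> P (B @^-1` [set beta x]) =
    (\sum_(y | Q y && (beta y == beta x)) p y)%:E) ->
  (forall x, \sum_(y | Q y) p y * sqnorm (batch_noise f b (beta y) x) = v x) ->
  ('E_P[fun w => sqnorm (batch_noise f b (B w) (z w))] =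
   'E_P[fun w => v (z w)])%E.
Proof.
move=> p0 p1 law vE.
pose H S w := sqnorm (batch_noise f b S (z w)).
have mH S : measurable_fun setT (H S).
  exact: (measurable_continuous_comp (@noise_cont S)).
have H0 S w : 0 <= H S w by exact: sqnorm_ge0.
rewrite (expectation_finite_law mB mH H0 _ p0 p1 law); last first.
  move=> S; apply: (independent_expectation (G := G)) => //.
  - move=> C GC; apply: ind => //.
    by exists [set S] => //; rewrite setTI.
  - exact: borel_measurable_comp sG mz (@noise_cont S).
transitivity ('E_P[fun w => (\sum_(y | Q y) p y * H (beta y) w)%R])%E.
  rewrite ge0_expectation_sum//.
  - by apply: eq_bigr => y _; rewrite ge0_expectationZl.
  - by move=> y; apply: measurable_funM => //.
  - by move=> y w; rewrite mulr_ge0.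
by apply: eq_expectation => w; exact: vE.
Qed.

Lemma batch_noise_sqnorm (s : seq 'I_N) x : size s = b ->
  sqnorm (batch_noise f b (seq_mset s) x) =
  b%:R ^- 2 * sqnorm (\sum_(i <- s) deviation f x i).
Proof.
move=> sb; rewrite batch_noise_seq// /sqnorm !dotv_linear mulrA.
by rewrite -expr2 exprVn.
Qed.

Lemma noise_second_moment (sch : sampling_scheme) : sampled_by P sch b B ->
  ('E_P[fun w => sqnorm (batch_noise f b (B w) (z w))] =
   'E_P[fun w => ((gen_batch_size R sch N b)^-1 * spread (z w))%R])%E.
Proof.
have N0 : N%:R != 0 :> R by rewrite pnatr_eq0 -lt0n.
have b0 : b%:R != 0 :> R by rewrite pnatr_eq0 -lt0n.
case: sch => [sB|[bN unif]].
  pose p (x : {ffun 'I_b -> 'I_N}) : R := N%:R ^- b.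
  apply: (@expectation_frozen _ xpredT mset_of_draws p
    (fun x => b%:R^-1 * spread x)).
  - by move=> x; rewrite /p invr_ge0 exprn_ge0.
  - rewrite sumr_const card_ffun !card_ord -[LHS]mulr_natr natrX mulVf//.
    exact: expf_neq0.
  - by move=> x _; rewrite (with_replacement_law mB sB).
  move=> x; rewrite /p -mulr_sumr.
  rewrite (eq_bigr (fun y : {ffun 'I_b -> 'I_N} =>
      b%:R ^- 2 * sqnorm (\sum_k deviation f x (y k)))); last first.
    move=> y _; rewrite /mset_of_draws batch_noise_sqnorm; last first.
      by rewrite size_map -cardE card_ord.
    by rewrite big_map big_enum.
  rewrite -mulr_sumr sum_ffun_sqnorm; last exact: sum_deviation hN df hf0 x.
  have -> : N%:R ^- b = N%:R^-1 * N%:R ^- b.-1 :> R.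
    by rewrite -{1}(prednK hb) exprS invfM.
  have Nb : N%:R ^+ b.-1 != 0 :> R by exact: expf_neq0.
  rewrite /spread; move: (N%:R ^+ b.-1) Nb => q q0.
  by field; rewrite N0 b0 q0.
have C0 : 'C(N, b)%:R != 0 :> R by rewrite pnatr_eq0 -lt0n bin_gt0 ltnW.
have N1 : (1 < N)%N by exact: leq_ltn_trans bN.
have N10 : N%:R - 1 != 0 :> R by rewrite subr_eq0 pnatr_eq1 gtn_eqF.
have Nb0 : N%:R - b%:R != 0 :> R by rewrite subr_eq0 eqr_nat gtn_eqF.
pose Q := [pred S : {set 'I_N} | #|S| == b].
pose beta (S : {set 'I_N}) := seq_mset (enum S).
have beta_inj : injective beta.
  move=> S S' /eq_seq_msetP SS'; apply/setP => i.
  by have := perm_mem SS' i; rewrite !mem_enum.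
apply: (@expectation_frozen _ Q beta (fun=> 'C(N, b)%:R^-1)
  (fun x => (gen_batch_size R without_replacement N b)^-1 * spread x)).
- by move=> _; rewrite invr_ge0.
- rewrite sumr_const -[LHS]mulr_natr.
  rewrite [X in _ * X%:R](_ : _ = 'C(N, b)) ?mulVf//.
  rewrite -[X in 'C(X, b)](card_ord N) -card_draws.
  by apply: eq_card => S; rewrite !inE.
- move=> S /eqP Sb; rewrite unif// (big_pred1 S)// => S' /=.
  rewrite (inj_eq beta_inj); case: (eqVneq S' S) => [->|]; rewrite ?andbF//.
  by rewrite Sb eqxx.
move=> x; rewrite -mulr_sumr.
rewrite (eq_bigr (fun S : {set 'I_N} =>
    b%:R ^- 2 * sqnorm (\sum_(i in S) deviation f x i))); last first.
  move=> S /eqP Sb; rewrite /beta batch_noise_sqnorm; last by rewrite -cardE.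
  by rewrite big_enum.
rewrite -mulr_sumr sum_subset_sqnorm//; last exact: sum_deviation hN df hf0 x.
rewrite /spread /gen_batch_size.
by field; rewrite N0 b0 C0 N10 Nb0.
Qed.

End OneStep.
End NoiseMoment.

(** * Linear combinations of integrable variables *)

Section LinearCombination.
Context {disp : measure_display} {T : measurableType disp} {R : realType}.
Variable P : probability T R.

Lemma expectation_linear (I : Type) (s : seq I) (c : I -> R) (X : I -> T -> R) :
  (forall i, X i \in Lfun P 1) ->
  (fun w => \sum_(i <- s) c i * X i w) \in Lfun P 1 /\
  ('E_P[fun w => (\sum_(i <- s) c i * X i w)%R] =
   \sum_(i <- s) (c i)%:E * 'E_P[X i])%E.
Proof.
move=> LX; elim: s => [|i s [LS ES]].
  rewrite big_nil (_ : (fun _ => _) = cst 0).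
    by rewrite expectation_cst; split => //; exact: Lfun_cst.
  by apply/funext => w; rewrite big_nil.
have E : (fun w => \sum_(j <- i :: s) c j * X j w) =
    (c i \o* X i) \+ (fun w => \sum_(j <- s) c j * X j w).
  by apply/funext => w; rewrite big_cons /= mulrC.
have LZ : c i \o* X i \in Lfun P 1 by exact: Lfun_scale.
rewrite E big_cons; split; first by rewrite rpredD.
by rewrite expectationD// expectationZl// ES.
Qed.

Lemma expectation_le0 (X : T -> R) : (forall w, X w <= 0) -> ('E_P[X] <= 0)%E.
Proof.
move=> X0; have NX0 w : [set: T] w -> (0 <= (- X w)%:E)%E.
  by rewrite lee_fin oppr_ge0.
rewrite unlock (eq_integral (fun w => - (- X w)%:E)%E); last first.
  by move=> w _; rewrite EFinN oppeK.
by rewrite integral_ge0N// oppe_le0 integral_ge0.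
Qed.

Lemma Lfun1_le (X Y : T -> R) : measurable_fun setT X -> Y \in Lfun P 1 ->
  (forall w, `|X w| <= Y w) -> X \in Lfun P 1.
Proof.
move=> mX /Lfun1_integrable LY XY; apply/Lfun1_integrable.
apply: (le_integrable measurableT _ _ LY); first exact/measurable_EFinP.
by move=> w _; rewrite /= lee_fin (le_trans (XY w))// ler_norm.
Qed.

Lemma ge0_Lfun1 (X : T -> R) : measurable_fun setT X -> (forall w, 0 <= X w) ->
  ('E_P[X] < +oo)%E -> X \in Lfun P 1.
Proof.
move=> mX X0; rewrite unlock => EX; apply/Lfun1_integrable/integrableP.
split; first exact/measurable_EFinP.
rewrite (_ : (fun _ => _) = (fun w => (X w)%:E))//.
by apply/funext => w; rewrite /= ger0_norm.
Qed.

End LinearCombination.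

(** * The inequality along a trajectory, and its expectation *)

Section Trajectory.
Context {R : realType} {d N : nat}.
Variables (m l : R) (f : 'I_N -> 'rV[R]_d -> R).
Hypotheses (hN : (0 < N)%N) (hml : m <= l).
Hypothesis df : forall i z, differentiable (f i) z.
Hypothesis hp : forall i, pinched m l (f i).
Hypothesis hf0 : grad (avg_fun f) 0 = 0.

(** With the spread in place of the noise the inequality is deterministic: the
    dissipation inequality reduces the delayed terms to the undelayed ones, and
    these leave just enough slack for the spread. *)
Lemma trajectory_inequality (rho : R) (s tau : nat) (lambda : 'I_s.+1 -> R)
    (x : nat -> 'rV[R]_d) :
  0 < rho -> rho <= 1 ->
  (forall k : 'I_s.+1, (0 < k)%N -> lambda k <= 0) ->
  0 <= \sum_(k < s.+1) rho ^- k * lambda k ->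
  \sum_(t < tau.+1) \sum_(k < s.+1) rho ^ (k%:Z - (2 * t)%:Z) * lambda k *
    dotv (shifted_grad (avg_fun f) m (x t))
      (if (k <= t)%N then shifted_grad (avg_fun f) l (x (t - k)%N) else 0)
  + (\sum_(k < s.+1) rho ^- k * lambda k) *
      \sum_(t < tau.+1) rho ^- (2 * t) * spread f (x t) <= 0.
Proof.
move=> rho0 rho1 hl c0; set c := \sum_(k < s.+1) _ in c0 *.
have fp := avg_pinched hN df hp.
set gm := shifted_grad (avg_fun f) m; set gl := shifted_grad (avg_fun f) l.
pose a t k := dotv (gm (x t)) (if (k <= t)%N then gl (x (t - k)%N) else 0).
pose phi t := energy m l (avg_fun f) (x t).
have a0E t : a t 0%N = dotv (gm (x t)) (gl (x t)) by rewrite /a subn0.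
have gl0 : gl 0 = 0 by rewrite /gl /shifted_grad hf0 scaler0 subr0.
(* the missing past is represented by the point 0, where gl and phi vanish *)
have a0 t : a t 0%N + phi t <= 0.
  have := energy_dissipation hml fp (x t) 0.
  by rewrite -/gm -/gl gl0 subr0 energy0// a0E /phi; lra.
have ak t k : a t 0%N + phi t - (if (k <= t)%N then phi (t - k)%N else 0)
    <= a t k.
  case: leqP => kt; last by rewrite {2}/a leqNgt kt dotv0r subr0.
  rewrite {2}/a kt a0E /phi.
  have := energy_dissipation hml fp (x t) (x (t - k)%N).
  by rewrite -/gm -/gl dotvDr dotvNr; lra.
have phi0 t : 0 <= phi t by exact: energy_ge0.
have := weighted_dissipation tau rho0 rho1 hl phi0 a0 ak; rewrite -/c.
suff : c * (\sum_(t < tau.+1) rho ^- (2 * t) * a t 0%N) +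
    c * (\sum_(t < tau.+1) rho ^- (2 * t) * spread f (x t)) <= 0.
  by rewrite /a; lra.
rewrite -mulrDr mulr_ge0_le0// -big_split/= sumr_le0// => t _.
rewrite -mulrDr mulr_ge0_le0//; first by rewrite invr_ge0 exprn_ge0// ltW.
by rewrite a0E; exact: deviation_budget.
Qed.

End Trajectory.

Theorem theorem9 (R : realType) (d N b : nat)
    (disp : measure_display) (T : measurableType disp) (P : probability T R)
    (m l : R) (hm : 0 < m) (hml : m <= l)
    (hN : (0 < N)%N) (hb : (0 < b)%N)
    (f : 'I_N -> 'rV[R]_d -> R) (hf : forall i, class_S m l (f i))
    (hf0 : grad (avg_fun f) 0 = 0)
    (sch : sampling_scheme) (B : nat -> T -> {mset 'I_N}%mset)
    (hB : forall t, sampled_by P sch b (B t))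
    (hBind : mutually_independent P B)
    (F : int -> set (set T)) (hF : filtration_from_m1 F)
    (hBF : forall t : nat, discrete_measurable_wrt (F t%:Z) (B t))
    (hBFind : forall t : nat, independent_systems P
       (preimage_set_system setT (B t) setT) (F (t%:Z - 1)))
    (rho : R) (hrho0 : 0 < rho) (hrho1 : rho <= 1)
    (s : nat) (lambda : 'I_s.+1 -> R)
    (hlambda : forall t : 'I_s.+1, (0 < t)%N -> lambda t <= 0)
    (hlambda_sum : 0 <= \sum_(t < s.+1) rho ^- t * lambda t)
    (z : nat -> T -> 'rV[R]_d)
    (hz : forall t : nat, borel_measurable_wrt (F (t%:Z - 1)) (z t))
    (hz2 : forall t : nat, ('E_P[fun w => sqnorm (z t w)] < +oo)%E)
    (tau : nat) :
  let gm t w := shifted_grad (avg_fun f) m (z t w) in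
  let gl t w := shifted_grad (avg_fun f) l (z t w) in
  (* gl_lag t k stands for g^l at time t - k *)
  let gl_lag (t k : nat) w := if (k <= t)%N then gl (t - k)%N w else 0 in
  let w1 t w := batch_noise f b (B t w) (z t w) in
  (\sum_(t < tau.+1) \sum_(k < s.+1)
      (rho ^ (k%:Z - (2 * t)%:Z) * lambda k)%:E *
      'E_P[fun w => dotv (gm t w) (gl_lag t k w)]
   + (gen_batch_size R sch N b * (\sum_(t < s.+1) rho ^- t * lambda t))%:E *
     (\sum_(t < tau.+1) (rho ^- (2 * t))%:E * 'E_P[fun w => sqnorm (w1 t w)])
   <= 0)%E.
Proof.
pose gm t w := shifted_grad (avg_fun f) m (z t w).
pose gl t w := shifted_grad (avg_fun f) l (z t w).
pose gl_lag t k w := if (k <= t)%N then gl (t - k)%N w else 0.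
pose w1 t w := batch_noise f b (B t w) (z t w).
pose c := \sum_(t < s.+1) rho ^- t * lambda t.
(* the let-bindings sit under the coercion of the inequality to a proposition *)
change (\sum_(t < tau.+1) \sum_(k < s.+1)
      (rho ^ (k%:Z - (2 * t)%:Z) * lambda k)%:E *
      'E_P[fun w => dotv (gm t w) (gl_lag t k w)]
   + (gen_batch_size R sch N b * c)%:E *
     (\sum_(t < tau.+1) (rho ^- (2 * t))%:E * 'E_P[fun w => sqnorm (w1 t w)])
   <= 0)%E.
have df i x : differentiable (f i) x by case: (hf i).
have hp i := class_S_pinched (hf i).
have sF t : sigma_algebra setT (F (t%:Z - 1)).
  by case: hF => sF _ _; apply: sF; rewrite lerBrDr addrC subrr.
have Fm t : F (t%:Z - 1) `<=` measurable.
  by case: hF => _ Fm _; apply: Fm; rewrite lerBrDr addrC subrr.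
have mB t C : measurable (B t @^-1` C).
  case: hF => _ Fm' _; apply: (Fm' t%:Z) => //; apply: hBF.
  by exists C => //; rewrite setTI.
have mcomp t (phi : 'rV[R]_d -> R) :
    continuous phi -> measurable_fun setT (phi \o z t).
  exact: (measurable_continuous_comp (sF t) (Fm t) (hz t)).
have scont := shifted_grad_cont hN hm hml df hp.
have LZ t : (fun w => sqnorm (z t w)) \in Lfun P 1.
  apply: ge0_Lfun1 => [|w|]; [|exact: sqnorm_ge0|exact: hz2].
  apply: (mcomp t (fun x => sqnorm x)).
  by apply: continuous_dotv; exact: coord_cont_id.
have LX t k : (fun w => dotv (gm t w) (gl_lag t k w)) \in Lfun P 1.
  rewrite /gl_lag; case: leqP => kt; last first.
    rewrite (_ : (fun _ => _) = cst 0); first exact: Lfun_cst.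
    by apply/funext => w; rewrite dotv0r.
  have [Km hKm] := shifted_grad_growth hN hml df hp hf0 hm m.
  have [Kl hKl] := shifted_grad_growth hN hml df hp hf0 hm l.
  apply: (@Lfun1_le _ _ _ P _ (((Km / 2) \o* fun w => sqnorm (z t w)) \+
     ((Kl / 2) \o* fun w => sqnorm (z (t - k)%N w)))).
  - rewrite (_ : (fun _ => _) = fun w => \sum_j gm t w 0 j * gl (t - k)%N w 0 j).
      apply: measurable_sum => j; apply: measurable_funM.
        exact: (mcomp t _ (scont m j)).
      exact: (mcomp (t - k)%N _ (scont l j)).
    by apply/funext => w; rewrite dotvE.
  - by apply: rpredD; apply: Lfun_scale.
  - move=> w /=; apply: (le_trans (dotv_young _ _)).
    by have := hKm (z t w); have := hKl (z (t - k)%N w); rewrite -/gm; lra.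
have mS t : measurable_fun setT (fun w => spread f (z t w)).
  rewrite /spread; apply: measurable_funM => //; apply: measurable_sum => i.
  have cdev : coord_cont (fun x => deviation f x i).
    exact: (@deviation_cont _ _ _ _ _ _ hN hm hml df hp).
  apply: (mcomp t (fun x => sqnorm (deviation f x i))).
  exact: continuous_dotv.
have LS t : (fun w => spread f (z t w)) \in Lfun P 1.
  have [K hK] := deviation_growth hN hml df hp hf0 hm.
  apply: (@Lfun1_le _ _ _ P _ (K \o* fun w => sqnorm (z t w))) => //.
    exact: Lfun_scale.
  by move=> w; rewrite ger0_norm ?spread_ge0//= mulrC; exact: hK.
have gen0 : 0 < gen_batch_size R sch N b.
  case: sch hB => [|hB] /=; first by rewrite ltr0n.
  have [bN _] := hB 0%N.
  rewrite divr_gt0 ?subr_gt0 ?ltr_nat// mulr_gt0 ?ltr0n// subr_gt0 ltr1n.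
  exact: leq_ltn_trans bN.
have noiseE t : ('E_P[fun w => sqnorm (w1 t w)] =
    (gen_batch_size R sch N b)^-1%:E * 'E_P[fun w => spread f (z t w)])%E.
  rewrite /w1 (noise_second_moment hN hb hm hml df hp hf0 (sF t) (Fm t) (mB t)
    (hz t) (hBFind t) (hB t)).
  apply: ge0_expectationZl => //; first by rewrite invr_ge0 ltW.
  by move=> w; exact: spread_ge0.
pose cf t (k : 'I_s.+1) := rho ^ (k%:Z - (2 * t)%:Z) * lambda k.
have EY t := expectation_linear (index_enum 'I_s.+1) (cf t) (fun k => LX t k).
have [LYs EYs] := expectation_linear (index_enum 'I_tau.+1) (fun=> 1)
  (fun t : 'I_tau.+1 => (EY t).1).
have [LSs ESs] := expectation_linear (index_enum 'I_tau.+1)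
  (fun t => c * rho ^- (2 * t)) (fun t : 'I_tau.+1 => LS t).
have -> : (\sum_(t < tau.+1) \sum_(k < s.+1) (cf t k)%:E *
    'E_P[fun w => dotv (gm t w) (gl_lag t k w)] =
  'E_P[fun w => (\sum_(t < tau.+1) 1 *
    \sum_(k < s.+1) cf t k * dotv (gm t w) (gl_lag t k w))%R])%E.
  by rewrite EYs; apply: eq_bigr => t _; rewrite mul1e (EY t).2.
have -> : ((gen_batch_size R sch N b * c)%:E *
    (\sum_(t < tau.+1) (rho ^- (2 * t))%:E * 'E_P[fun w => sqnorm (w1 t w)]) =
  'E_P[fun w => (\sum_(t < tau.+1) c * rho ^- (2 * t) * spread f (z t w))%R])%E.
  rewrite ESs ge0_sume_distrr; last first.
    move=> t _; apply: mule_ge0.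
      by rewrite lee_fin invr_ge0 exprn_ge0// ltW.
    by apply: expectation_ge0 => w; exact: sqnorm_ge0.
  apply: eq_bigr => t _; rewrite noiseE !muleA -!EFinM; congr (_%:E * _)%E.
  move: (gen_batch_size R sch N b) gen0 (rho ^- (2 * t)) => g g0 q.
  by field; rewrite gt_eqF.
rewrite -expectationD//; apply: expectation_le0 => w /=.
have := trajectory_inequality hN hml df hp hf0 tau (fun t => z t w) hrho0 hrho1
  hlambda hlambda_sum.
rewrite mulr_sumr; under [X in _ -> X + _ <= _]eq_bigr do rewrite mul1r.
by under [X in _ -> _ + X <= _]eq_bigr do rewrite -mulrA.
Qed.
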